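(* Assume that $\mathrm S$ and $\mathbb U$ are compact and that $\lambda>\frac N2\operatorname{diam}(\mathrm S,\|\cdot\|_2)^2$. Define functions on $\mathcal P(\mathbb X)^K$ by the dynamic programming equations $$\mathfrak C_T(\mu^1,\dots,\mu^K):=\frac1K\sum_{k=1}^K W_{2,\lambda}(\mu^k,\nu^k)^2,$$ $$\mathfrak C_t(\mu^1,\dots,\mu^K):=\inf_{U\in\mathbb U}\int_{\mathcal P(\mathbb X)^K}\eta(d\mu_{t+1}^1,\dots,d\mu_{t+1}^K\mid\mu^1,\dots,\mu^K;U)\,\mathfrak C_{t+1}(\mu_{t+1}^1,\dots,\mu_{t+1}^K),\qquad t\in\{0,\dots,T-1\}.$$ Then there exists a deterministic Markov policy $\underline\gamma^*=(\gamma_t^* )_{t=0}^{T-1}\in\Gamma$, with $\gamma_t^*(\mu_t^1,\dots,\mu_t^K)=U_t^*\in\mathbb U$, such that $$V(\underline\gamma^* )=\inf_{\underline\gamma\in\Gamma}V(\underline\gamma).$$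
   Context: Fix integers $N,K,d,d_1,d_2,T\ge1$, $\beta>0$, $\lambda>0$. Let $\emptyset\ne\mathrm S\subset\mathbb R^d$, $p_i:=i/N$, $\mathrm{PE}_N:=\{p_1,\dots,p_N\}$, $\mathbb X:=\mathrm{PE}_N\times\mathrm S$. Let $\sigma:\mathbb R^{d_1}\to\mathbb R^{d_1}$ be $1$-Lipschitz. The action space $\mathbb U$ is a nonempty subset of $\mathbb R^{d\times d_1}\times\mathbb R^{d_1\times d}\times\mathbb R^{d_1}\times\mathbb R^{d_2\times d}\times\mathbb R^{d_2\times d}\times\mathbb R^{d\times d}$ with the Euclidean (product Frobenius) norm; its elements are written $U=(\mathsf W,\mathsf A,\mathsf b,\mathsf Q,\mathsf K,\mathsf V)$. $\mathcal P(\Omega)$ denotes the Borel probability measures on $\Omega$, with the topology of weak convergence (convergence against bounded continuous functions); $\mathcal P(\mathbb X)^K$ carries the product topology and Borel $\sigma$-field. For $\mu\in\mathcal P(\mathbb X)$, $\mu_{\mathrm S}$ is its marginal on $\mathrm S$. Define $f:\mathbb X\times\mathbb U\times\mathcal P(\mathbb X)\to\mathbb X$ by $$f((p,x),U,\mu):=\Big(p,\ \mathsf W\sigma(\mathsf Ax+\mathsf b)+\frac{\int_{\mathrm S}e^{\beta\langle\mathsf Qx,\mathsf Kz\rangle}\mathsf Vz\,\mu_{\mathrm S}(dz)}{\int_{\mathrm S}e^{\beta\langle\mathsf Qx,\mathsf Kz\rangle}\mu_{\mathrm S}(dz)}\Big);$$ it is a standing convention that $f$ is $\mathbb X$-valued.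 Let $\Phi(\mu,U):=\mu\circ f(\cdot,U,\mu)^{-1}$ (push-forward of $\mu$), $\boldsymbol\Phi(\mu^1,\dots,\mu^K;U):=(\Phi(\mu^1,U),\dots,\Phi(\mu^K,U))$ and $\eta(\cdot\mid\mu^1,\dots,\mu^K;U):=\delta_{\boldsymbol\Phi(\mu^1,\dots,\mu^K;U)}(\cdot)$. $W_{2,\lambda}(P,Q):=\big(\inf_\pi\int(\|x-y\|_2^2+\lambda|p-q|^2)\,\pi(d(p,x),d(q,y))\big)^{1/2}$, the infimum being over couplings $\pi$ of $P,Q\in\mathcal P(\mathbb X)$. $\operatorname{diam}(\mathrm S,\|\cdot\|_2):=\sup_{x,y\in\mathrm S}\|x-y\|_2$. Data: $(\mathbf x^k,\mathbf y^k)\in\mathrm S^N\times\mathrm S^N$, $k=1,\dots,K$, with $\mathbf x^k=(x^{1,k},\dots,x^{N,k})$, $\mathbf y^k=(y^{1,k},\dots,y^{N,k})$; put $\mu_0^k:=\frac1N\sum_{i=1}^N\delta_{(p_i,x^{i,k})}$, $\nu^k:=\frac1N\sum_{i=1}^N\delta_{(p_i,y^{i,k})}$. $\Gamma$ is the set of deterministic Markov policies, i.e. sequences $\underline\gamma=(\gamma_t)_{t=0}^{T-1}$ of measurable maps $\gamma_t:\mathcal P(\mathbb X)^K\to\mathbb U$. Under $\underline\gamma$ the measures evolve from $(\mu_0^1,\dots,\mu_0^K)$ by $U_t=\gamma_t(\mu_t^1,\dots,\mu_t^K)$, $\mu_{t+1}^k=\Phi(\mu_t^k,U_t)$, and $V(\underline\gamma):=\frac1K\sum_{k=1}^KW_{2,\lambda}(\mu_T^k,\nu^k)^2$.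 *)

(* Defs.v *)
From HB Require Import structures.
From mathcomp Require Import all_boot all_order all_algebra.
From mathcomp Require Import all_classical all_reals all_analysis.
From mathcomp Require Import measurable_realfun.

Set Implicit Arguments.
Unset Strict Implicit.
Unset Printing Implicit Defensive.
Import Order.TTheory GRing.Theory Num.Theory.
Import numFieldNormedType.Exports.
Local Open Scope classical_set_scope.
Local Open Scope ring_scope.

(* A nonempty subset as a type, with the subspace topology; nonemptiness makes
   it a pointed type, which the library requires of measurable types. *)
Definition nesub {T : Type} {A : set T} (A0 : A !=set0) : Type := set_type A.

Definition in_nesub {T : Type} {A : set T} (A0 : A !=set0) {x : T} (Ax : A x) :
  nesub A0 := exist (fun x => x \in A) x (mem_set Ax).

Definition nesub_point {T : Type} {A : set T} (A0 : A !=set0) : nesub A0 :=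
  in_nesub A0 (projT2 (cid A0)).

HB.instance Definition _ (T : topologicalType) (A : set T) (A0 : A !=set0) :=
  Topological.copy (nesub A0) (set_type A).
HB.instance Definition _ (T : topologicalType) (A : set T) (A0 : A !=set0) :=
  isPointed.Build (nesub A0) (nesub_point A0).

Notation borel T := (g_sigma_algebraType (@open T)).

Section Euclidean.
Context {R : realType}.

Definition dotv {n : nat} (u v : 'cV[R]_n) : R := (u^T *m v) 0 0.

(* The library's norm on matrices is the sup norm, hence this definition. *)
Definition enorm {n : nat} (u : 'cV[R]_n) : R := Num.sqrt (dotv u u).

Definition diam {n : nat} (A : set 'cV[R]_n) : R :=
  sup [set enorm (xy.1 - xy.2) | xy in A `*` A].

Definition lipschitz1 {m n : nat} (s : 'cV[R]_m -> 'cV[R]_n) : Prop :=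
  forall x y, enorm (s x - s y) <= enorm (x - y).

End Euclidean.

Section WeakTopology.
Context {R : realType}.

Record bcfun (T : topologicalType) := BCFun {
  bcfun_val :> T -> R;
  bcfun_continuous : continuous bcfun_val;
  bcfun_bounded : exists M : R, forall x, `|bcfun_val x| <= M }.

Definition weak_eval (T : ptopologicalType) (mu : probability (borel T) R) :
    prod_topology (fun _ : bcfun T => R) :=
  fun g => \int[mu]_x g x.

(* The coarsest topology making mu |-> \int g dmu continuous for every bounded
   continuous g. *)
Definition Prob (T : ptopologicalType) : Type :=
  initial_topology (@weak_eval T).

HB.instance Definition _ (T : ptopologicalType) :=
  Topological.copy (Prob T) (initial_topology (@weak_eval T)).
HB.instance Definition _ (T : ptopologicalType) :=
  Pointed.copy (Prob T) (initial_topology (@weak_eval T)).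

Definition ProbK (T : ptopologicalType) (K : nat) : Type :=
  prod_topology (fun _ : 'I_K => Prob T).

HB.instance Definition _ (T : ptopologicalType) (K : nat) :=
  Topological.copy (ProbK T K) (prod_topology (fun _ : 'I_K => Prob T)).
HB.instance Definition _ (T : ptopologicalType) (K : nat) :=
  isPointed.Build (ProbK T K) (fun=> point).

End WeakTopology.
Arguments bcfun : clear implicits.
Arguments Prob : clear implicits.
Arguments ProbK : clear implicits.

Section Measurability.
Context {R : realType}.

Lemma open_borel (T : ptopologicalType) (A : set T) :
  open A -> measurable (A : set (borel T)).
Proof. by move=> oA; exact: sub_gen_smallest. Qed.

Lemma continuous_borel (T : ptopologicalType) (f : T -> R) :
  continuous f -> measurable_fun setT (f : borel T -> R).
Proof.
move=> /continuousP cf; apply: (measurability _ (RGenOpens.measurableE R)).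
move=> _ [_ [a [b ->]] <-]; rewrite setTI; apply: open_borel.
by apply: cf; exact: interval_open.
Qed.

Lemma dense_rat_ball (x e : R) : 0 < e -> exists q : rat, ball x e (ratr q).
Proof.
move=> e0; have [q] : exists q : rat, ratr q \in `]x - e, x + e[.
  by apply: rat_in_itvoo; rewrite ltrD2l gtrN.
by rewrite in_itv/= => qx; exists q; rewrite -ball_normE /= distrC ltr_distl.
Qed.

Lemma measurable_to_nesub d (T : measurableType d) (n : nat)
    (A : set (R * 'cV[R]_n)) (A0 : A !=set0) (g : T -> nesub A0) :
  measurable_fun setT (fun x => (\val (g x)).1) ->
  (forall i, measurable_fun setT (fun x => (\val (g x)).2 i 0)) ->
  measurable_fun setT (g : T -> borel (nesub A0)).
Proof.
move=> m1 m2.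
pose I := (rat * 'cV[rat]_n * nat)%type.
pose box (t : I) : set (R * 'cV[R]_n) :=
  [set y : R * 'cV[R]_n | ball (ratr t.1.1 : R) t.2.+1%:R^-1 y.1 /\
    forall i, ball (ratr (t.1.2 i 0) : R) t.2.+1%:R^-1 (y.2 i 0)].
have mball q (e : R) (h : T -> R) : measurable_fun setT h ->
    measurable (h @^-1` ball q e).
  move=> mh; rewrite -[X in measurable X]setTI; apply: mh => //.
  by apply: open_measurable; exact: ball_open.
have mbox t : measurable [set x | box t (\val (g x))].
  rewrite [X in measurable X](_ : _ =
    ((fun x => (\val (g x)).1) @^-1` ball (ratr t.1.1 : R) t.2.+1%:R^-1) `&`
    \bigcap_(i : 'I_n) ((fun x => (\val (g x)).2 i 0) @^-1`
       ball (ratr (t.1.2 i 0) : R) t.2.+1%:R^-1)).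
    apply: measurableI; first exact: mball.
    apply: fin_bigcap_measurable; first exact: finite_finset.
    by move=> i _; exact: mball.
  apply/seteqP; split => [x [h1 h2]|x [h1 h2]].
    by split=> // i _; exact: h2.
  by split=> // i; exact: h2.
apply: (@measurability _ _ T (borel (nesub A0)) setT g
  (@open (nesub A0))) => //.
move=> _ [_ [B oB <-] <-]; rewrite setTI.
pose J : set I := [set t | box t `<=` B].
rewrite [X in measurable X](_ : _ =
    \bigcup_(t : I)
      (if pselect (J t) then [set x | box t (\val (g x))] else set0)).
  apply: countable_bigcupT_measurable; first exact: countableP.
  by move=> t; case: pselect => [Jt|nJt]; [exact: mbox|exact: measurable0].
apply/seteqP; split => [x Bx|x [t _]]; last first.
  by case: pselect => // Jt /Jt.
have {Bx} Bx : B (\val (g x)) by [].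
have /nbhs_ballP[e /= e0 eB] : nbhs (\val (g x)) B by exact: open_nbhs_nbhs.
have e20 : 0 < e / 2 by rewrite divr_gt0.
have [N /= Ne] : exists N : nat, N.+1%:R^-1 < e / 2.
  by exists (Num.truncn (e / 2)^-1); rewrite invf_plt ?posrE// truncnS_gt.
have N0 : 0 < N.+1%:R^-1 :> R by rewrite invr_gt0.
have [q hq] := dense_rat_ball (\val (g x)).1 N0.
have /choice[w hw] i := dense_rat_ball ((\val (g x)).2 i 0) N0.
have bb : box (q, \col_i w i, N) (\val (g x)).
  split=> [|i] /=; first exact: ball_sym.
  by rewrite mxE; exact: ball_sym.
exists (q, \col_i w i, N) => //; case: pselect => //; case.
move=> y [/= y1 y2]; apply: eB; split=> /=.
  apply: (@le_ball _ _ _ (N.+1%:R^-1 + N.+1%:R^-1)).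
    by rewrite [leRHS]splitr lerD// ltW.
  by apply: ball_triangle hq _.
split=> // i j; rewrite (ord1 j).
apply: (@le_ball _ _ _ (N.+1%:R^-1 + N.+1%:R^-1)).
  by rewrite [leRHS]splitr lerD// ltW.
by apply: ball_triangle (hw i) _; move: (y2 i); rewrite mxE.
Qed.

Lemma measurable_Rint d1 d2 (X : measurableType d1) (Y : measurableType d2)
    (nu : probability Y R) (h : X * Y -> R) :
  measurable_fun setT h ->
  measurable_fun setT (fun x => (\int[nu]_y h (x, y))%R).
Proof.
move=> mh; apply: measurableT_comp => //=.
under eq_fun do rewrite integralE.
have mE : measurable_fun setT (EFin \o h) by exact/measurable_EFinP.
apply: emeasurable_funB.
  rewrite (_ : (fun x => _) = fubini_F nu ((EFin \o h)^\+)%E).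
    exact: (measurable_fun_fubini_tonelli_F _ (measurable_funepos mE)).
  by apply/funext => x; apply: eq_integral => y _; rewrite !funeposE.
rewrite (_ : (fun x => _) = fubini_F nu ((EFin \o h)^\-)%E).
  exact: (measurable_fun_fubini_tonelli_F _ (measurable_funeneg mE)).
by apply/funext => x; apply: eq_integral => y _; rewrite !funenegE.
Qed.

Lemma dotvE n (u v : 'cV[R]_n) : dotv u v = \sum_i u i 0 * v i 0.
Proof. by rewrite /dotv mxE; apply: eq_bigr => i _; rewrite mxE. Qed.

Lemma coord_le_enorm n (u : 'cV[R]_n) i : `|u i 0| <= enorm u.
Proof.
rewrite /enorm dotvE -sqrtr_sqr ler_wsqrtr// (bigD1 i)//= expr2 lerDl.
by apply: sumr_ge0 => j _; rewrite -expr2 sqr_ge0.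
Qed.

Lemma enorm_le n (u : 'cV[R]_n) (e : R) :
  0 <= e -> (forall i, `|u i 0| <= e / n.+1%:R) -> enorm u <= e.
Proof.
move=> e0 ue; rewrite -[leRHS]ger0_norm// -sqrtr_sqr ler_wsqrtr// dotvE.
apply: (@le_trans _ _ (\sum_(i < n) (e / n.+1%:R) ^+ 2)).
  apply: ler_sum => i _; rewrite -expr2 -real_normK ?num_real//.
  by rewrite lerXn2r// nnegrE ?divr_ge0.
rewrite sumr_const card_ord -[_ *+ n]mulr_natr exprMn -[_ * _ * n%:R]mulrA.
apply: ler_piMr; rewrite ?sqr_ge0//.
rewrite exprVn mulrC ler_pdivrMr ?exprn_gt0// mul1r -natrX ler_nat.
by rewrite (@leq_trans n.+1)// -[leqLHS]expn1 leq_pexp2l.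
Qed.

Lemma lipschitz1_continuous m n (s : 'cV[R]_m -> 'cV[R]_n) :
  lipschitz1 s -> continuous s.
Proof.
move=> ls x B /nbhs_ballP[e /= e0 eB]; apply/nbhs_ballP.
have d0 : 0 < e / 2 / m.+1%:R by rewrite !divr_gt0.
exists (e / 2 / m.+1%:R) => //= y [_ xy]; apply: eB; split=> // i j.
rewrite (ord1 j) -ball_normE /=.
have -> : s x i 0 - s y i 0 = (s x - s y) i 0 by rewrite !mxE.
apply: (le_lt_trans (coord_le_enorm _ _)).
apply: (le_lt_trans (ls _ _)); apply: (@le_lt_trans _ _ (e / 2)); last first.
  by rewrite ltr_pdivrMr// ltr_pMr// ltr1n.
apply: enorm_le => [|k]; first by rewrite ltW// divr_gt0.
by move: (xy k 0); rewrite -ball_normE /= !mxE => /ltW.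
Qed.

Lemma affine_coord_continuous m n (A : 'M[R]_(m, n)) (b : 'cV[R]_m) i j :
  continuous (fun v : 'cV[R]_n => (A *m v + b) i j).
Proof.
have -> : (fun v : 'cV[R]_n => (A *m v + b) i j) =
    (fun v : 'cV[R]_n => \sum_k A i k * v k j + b i j).
  by apply/funext => v; rewrite !mxE.
move=> v; apply: (@cvgD R R^o _ (nbhs v)); last exact: cvg_cst.
apply: (@cvg_big _ _ _ _ _ (@add_continuous R^o) _ (nbhs v)) => k _.
apply: (@cvgM _ _ (nbhs v)); first exact: cvg_cst.
exact: coord_continuous.
Qed.

Lemma affine_continuous m n (A : 'M[R]_(m, n)) (b : 'cV[R]_m) :
  continuous (fun v : 'cV[R]_n => A *m v + b).
Proof.
move=> v B [P nP sP].
have nearP : \forall w \near v, forall i j, P i j ((A *m w + b) i j).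
  apply: (@filter_forall _ _ (fun i => [set w : 'cV[R]_n |
    forall j, P i j ((A *m w + b) i j)]) (nbhs v)) => i.
  apply: (@filter_forall _ _ (fun j => [set w : 'cV[R]_n |
    P i j ((A *m w + b) i j)]) (nbhs v)) => j.
  exact: (@affine_coord_continuous _ _ A b i j v _ (nP i j)).
by apply: filterS nearP => w; exact: sP.
Qed.

End Measurability.

Section Pushforward.
Context {R : realType}.

Lemma continuous_borel2 (T1 T2 : ptopologicalType) (f : T1 -> T2) :
  continuous f -> measurable_fun setT (f : borel T1 -> borel T2).
Proof.
move=> /continuousP cf.
apply: (@measurability _ _ (borel T1) (borel T2) setT f (@open T2)) => //.
by move=> _ [B oB <-]; rewrite setTI; apply: open_borel; exact: cf.
Qed.

Definition pushp {T1 T2 : ptopologicalType} (mu : Prob R T1) (f : T1 -> T2)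
    (mf : measurable_fun setT (f : borel T1 -> borel T2)) : Prob R T2 :=
  distribution mu (mfun_Sub (mem_set mf) : {mfun borel T1 >-> borel T2}).

End Pushforward.

Section Empirical.
Context {R : realType} {T : ptopologicalType} {N : nat}.

Definition empirical_measure (N0 : (0 < N)%N) (pts : 'I_N -> T)
    (A : set (borel T)) : \bar R :=
  ((N%:R^-1)%:E * \sum_(i < N) \d_(pts i : borel T) A)%E.

Variables (N0 : (0 < N)%N) (pts : 'I_N -> T).

Let invN_ge0 : 0 <= N%:R^-1 :> R. Proof. by rewrite invr_ge0. Qed.

Let dirac_nat (i : nat) : {measure set (borel T) -> \bar R} :=
  dirac (pts (insubd (Ordinal N0) i) : borel T).

Lemma empirical_measureE : empirical_measure N0 pts =
  mscale (NngNum invN_ge0) (msum dirac_nat N).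
Proof.
apply/funext => A; rewrite /empirical_measure /mscale /msum /=.
by congr (_ * _)%E; apply: eq_bigr => i _; rewrite /dirac_nat valKd.
Qed.

Let empirical0 : empirical_measure N0 pts set0 = 0%E.
Proof. by rewrite empirical_measureE measure0. Qed.

Let empirical_ge0 A : (0 <= empirical_measure N0 pts A)%E.
Proof. by rewrite empirical_measureE measure_ge0. Qed.

Let empirical_sigma_additive : semi_sigma_additive (empirical_measure N0 pts).
Proof. by rewrite empirical_measureE; exact: measure_semi_sigma_additive. Qed.

HB.instance Definition _ := isMeasure.Build _ _ _ (empirical_measure N0 pts)
  empirical0 empirical_ge0 empirical_sigma_additive.

Let empirical_setT : empirical_measure N0 pts setT = 1%E.
Proof.
rewrite /empirical_measure; under eq_bigr do rewrite diracT.
rewrite sumEFin -EFinM sumr_const card_ord mulVf// pnatr_eq0.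
by rewrite -lt0n.
Qed.

HB.instance Definition _ := Measure_isProbability.Build _ _ _
  (empirical_measure N0 pts) empirical_setT.

Definition empirical : Prob R T := empirical_measure N0 pts.

End Empirical.

Section EncodedTokens.
Context {R : realType} {N d : nat} {S : set 'cV[R]_d}.
Variables (N0 : (0 < N)%N) (S0 : S !=set0).

Definition posenc (i : 'I_N) : R := i.+1%:R / N%:R.
Definition PE : set R := range posenc.

Lemma encoded_neq0 : PE `*` S !=set0.
Proof.
have [x Sx] := S0; exists (posenc (Ordinal N0), x).
by split=> //; exists (Ordinal N0).
Qed.

Definition token : ptopologicalType := nesub S0.
Definition encoded : ptopologicalType := nesub encoded_neq0.

Definition enc_pos (x : encoded) : R := (\val x).1.
Definition enc_tok (x : encoded) : 'cV[R]_d := (\val x).2.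

Lemma PE_enc_pos (x : encoded) : PE (enc_pos x).
Proof. exact: (set_mem (valP x)).1. Qed.

Lemma S_enc_tok (x : encoded) : S (enc_tok x).
Proof. exact: (set_mem (valP x)).2. Qed.

Definition enc (i : 'I_N) (x : token) : encoded :=
  in_nesub encoded_neq0 (x := (posenc i, \val x))
    (conj (imageT posenc i) (set_mem (valP x))).

Definition proj_token (x : encoded) : token := in_nesub S0 (S_enc_tok x).

Lemma continuous_proj_token : continuous proj_token.
Proof.
apply/continuousP => _ [B oB <-]; exists (snd @^-1` B) => //.
have c : continuous (snd : R * 'cV[R]_d -> 'cV[R]_d).
  by move=> y; exact: cvg_snd.
by move/continuousP : c; exact.
Qed.

Definition marginal (mu : Prob R encoded) : Prob R token :=
  pushp mu (continuous_borel2 continuous_proj_token).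

(* A [probability] is a set function on all subsets, so marginals are compared
   on measurable sets only. *)
Definition couplings (P Q : Prob R encoded) :
    set (probability (borel encoded * borel encoded)%type R) :=
  [set pi | forall A : set (borel encoded), measurable A ->
    pi (A `*` setT) = (P : probability _ R) A /\
    pi (setT `*` A) = (Q : probability _ R) A].

Definition transport_cost (lambda : R) (z : encoded * encoded) : R :=
  enorm (enc_tok z.1 - enc_tok z.2) ^+ 2 +
  lambda * `|enc_pos z.1 - enc_pos z.2| ^+ 2.

Definition W2 (lambda : R) (P Q : Prob R encoded) : \bar R :=
  (ereal_inf [set \int[pi]_z (transport_cost lambda z)%:E
             | pi in couplings P Q] `^ 2^-1)%E.

End EncodedTokens.
Arguments enc_pos {R N d S N0 S0} x.
Arguments enc_tok {R N d S N0 S0} x.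

(* The tuples (W, A, b, Q, K, V), with the product topology, which is the
   topology of the Euclidean norm. *)
Definition param (R : realType) (d d1 d2 : nat) : topologicalType :=
  ('M[R]_(d, d1) * 'M[R]_(d1, d) * 'cV[R]_d1 *
   'M[R]_(d2, d) * 'M[R]_(d2, d) * 'M[R]_(d, d))%type.

Section Transformer.
Context {R : realType} {N K d d1 d2 T : nat}.
Context {S : set 'cV[R]_d} {U : set (param R d d1 d2)}.
Variables (beta : R) (sigma : 'cV[R]_d1 -> 'cV[R]_d1).
Variables (N0 : (0 < N)%N) (S0 : S !=set0) (U0 : U !=set0).

Local Notation X := (encoded N0 S0).
Local Notation PX := (Prob R X).
Local Notation PXK := (ProbK R X K).

Definition action : ptopologicalType := nesub U0.

Definition attention (Q Ky : 'M[R]_(d2, d)) (Vl : 'M[R]_(d, d))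
    (nu : Prob R (token S0)) (x : 'cV[R]_d) : 'cV[R]_d :=
  \col_i
    ((\int[nu]_z
        (expR (beta * dotv (Q *m x) (Ky *m \val z)) * (Vl *m \val z) i 0)) /
     (\int[nu]_z expR (beta * dotv (Q *m x) (Ky *m \val z)))).

Definition f_token (x : X) (u : action) (mu : PX) : 'cV[R]_d :=
  let: (W, A, b, Q, Ky, Vl) := \val u in
  W *m sigma (A *m enc_tok x + b) + attention Q Ky Vl (marginal mu) (enc_tok x).

(* The values of f are (p, f_token), so f is X-valued iff f_token lies in S. *)
Definition f_X_valued : Prop := forall x u mu, S (f_token x u mu).

Variables (fX : f_X_valued) (lip_sigma : lipschitz1 sigma).

Definition f_map (x : X) (u : action) (mu : PX) : X :=
  in_nesub (encoded_neq0 N0 S0) (x := (enc_pos x, f_token x u mu))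
    (conj (PE_enc_pos x) (fX x u mu)).

Lemma continuous_enc_pos : continuous (enc_pos : X -> R).
Proof.
apply/continuousP => B oB; exists (fst @^-1` B) => //.
have c : continuous (fst : R * 'cV[R]_d -> R) by move=> y; exact: cvg_fst.
by move/continuousP : c; exact.
Qed.

Lemma continuous_enc_tok : continuous (enc_tok : X -> 'cV[R]_d).
Proof.
apply/continuousP => B oB; exists (snd @^-1` B) => //.
have c : continuous (snd : R * 'cV[R]_d -> 'cV[R]_d).
  by move=> y; exact: cvg_snd.
by move/continuousP : c; exact.
Qed.

Lemma measurable_enc_tok i :
  measurable_fun setT ((fun x : X => enc_tok x i 0) : borel X -> R).
Proof.
apply: continuous_borel => x.
apply: (@continuous_comp _ _ _ enc_tok (fun v : 'cV[R]_d => v i 0)).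
  exact: continuous_enc_tok.
exact: coord_continuous.
Qed.

Lemma measurable_token i :
  measurable_fun setT
    ((fun z : token S0 => (\val z) i 0) : borel (token S0) -> R).
Proof.
apply: continuous_borel; apply/continuousP => B oB.
exists ((fun v : 'cV[R]_d => v i 0) @^-1` B) => //.
by move/continuousP : (@coord_continuous R d 1 i 0); exact.
Qed.

Lemma measurable_mulmx d0 (Z : measurableType d0) m n (M : 'M[R]_(m, n))
    (h : Z -> 'cV[R]_n) :
  (forall i, measurable_fun setT (fun z => h z i 0)) ->
  forall i, measurable_fun setT (fun z => (M *m h z) i 0).
Proof.
move=> mh i; under eq_fun do rewrite mxE.
by apply: measurable_sum => j; apply: measurable_funM.
Qed.

Lemma measurable_attention (Q Ky : 'M[R]_(d2, d)) (Vl : 'M[R]_(d, d))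
    (nu : Prob R (token S0)) i :
  measurable_fun setT
    ((fun x : X => attention Q Ky Vl nu (enc_tok x) i 0) : borel X -> R).
Proof.
pose e (xz : borel X * borel (token S0)) : R :=
  expR (beta * dotv (Q *m enc_tok (xz.1 : X)) (Ky *m \val xz.2)).
have mx j : measurable_fun setT
    (fun xz : borel X * borel (token S0) => enc_tok (xz.1 : X) j 0).
  exact: (measurableT_comp (measurable_enc_tok j) measurable_fst).
have mz j : measurable_fun setT
    (fun xz : borel X * borel (token S0) => (\val xz.2) j 0).
  exact: (measurableT_comp (measurable_token j) measurable_snd).
have me : measurable_fun setT e.
  apply: (measurableT_comp (@measurable_expR R)); apply: measurable_funM => //.
  under eq_fun do rewrite dotvE.
  apply: measurable_sum => j; apply: measurable_funM.
    exact: (measurable_mulmx Q mx).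
  exact: (measurable_mulmx Ky mz).
under eq_fun do rewrite mxE.
apply: measurable_funM.
  apply: (@measurable_Rint R _ _ (borel X) (borel (token S0)) nu
    (fun xz => e xz * (Vl *m \val xz.2) i 0)).
  apply: measurable_funM => //.
  exact: (measurable_mulmx Vl mz).
rewrite (_ : (fun x => _) = (@powR R ^~ (- 1)) \o
    (fun x : borel X => (\int[nu]_z e (x, z))%R)).
  apply: measurableT_comp; first exact: measurable_powR.
  exact: (@measurable_Rint R _ _ (borel X) (borel (token S0)) nu e).
apply/funext => x /=; rewrite powR_inv1//.
by apply: Rintegral_ge0 => z _; exact: expR_ge0.
Qed.

Lemma measurable_f_map (u : action) (mu : PX) :
  measurable_fun setT ((fun x => f_map x u mu) : borel X -> borel X).
Proof.
apply: measurable_to_nesub => [|i] /=.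
  by apply: continuous_borel; exact: continuous_enc_pos.
rewrite /f_token; case: (\val u) => [[[[[W A] b] Q] Ky] Vl].
under eq_fun do rewrite mxE.
apply: measurable_funD; last exact: measurable_attention.
apply: (measurable_mulmx _
  (h := fun x : borel X => sigma (A *m enc_tok x + b))) => j.
apply: continuous_borel => x.
apply: (@continuous_comp _ _ _ (fun x : X => sigma (A *m enc_tok x + b))
  (fun v : 'cV[R]_d1 => v j 0)); last exact: coord_continuous.
apply: (@continuous_comp _ _ _ (fun x : X => A *m enc_tok x + b) sigma).
  apply: (@continuous_comp _ _ _ (fun x : X => enc_tok x)
    (fun v => A *m v + b)).
    exact: continuous_enc_tok.
  exact: affine_continuous.
exact: lipschitz1_continuous.
Qed.

Definition Phi (mu : PX) (u : action) : PX := pushp mu (measurable_f_map u mu).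

Definition bPhi (mu : PXK) (u : action) : PXK := fun k => Phi (mu k) u.

Definition eta (mu : PXK) (u : action) : probability (borel PXK) R :=
  \d_(bPhi mu u : borel PXK).

Definition policy : Type := 'I_T -> PXK -> action.

Definition Gamma : set policy :=
  [set gamma | forall t,
    measurable_fun setT (gamma t : borel PXK -> borel action)].

(* Only the values at times t <= T are meaningful. *)
Fixpoint evolution (gamma : policy) (mu0 : PXK) (t : nat) : PXK :=
  if t is s.+1 then
    let mu := evolution gamma mu0 s in
    if insub s is Some i then bPhi mu (gamma i mu) else mu
  else mu0.

Definition terminal_cost (lambda : R) (nu mu : PXK) : \bar R :=
  ((K%:R^-1)%:E * \sum_(k < K) W2 lambda (mu k) (nu k) ^+ 2)%E.

Definition sample_measure (xs : 'I_K -> 'I_N -> token S0) : PXK :=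
  fun k => empirical N0 (fun i => enc N0 i (xs k i)).

Definition policy_cost (lambda : R) (xs ys : 'I_K -> 'I_N -> token S0)
    (gamma : policy) : \bar R :=
  terminal_cost lambda (sample_measure ys)
    (evolution gamma (sample_measure xs) T).

End Transformer.
Arguments policy {R N} K {d d1 d2} T {S U} N0 S0 U0.
Arguments Gamma {R N K d d1 d2 T S U N0 S0 U0} _.

(* Main.v *)
Require Import Defs.
From mathcomp Require Import all_boot all_order all_algebra.
From mathcomp Require Import all_classical all_reals all_analysis.
From mathcomp Require Import measurable_realfun ring lra.
Import Order.TTheory GRing.Theory Num.Theory.
Import numFieldNormedType.Exports.
Local Open Scope classical_set_scope.
Local Open Scope ring_scope.

(** The evolution is deterministic and starts at a fixed state, so each feedback
    policy has the same cost as the sequence of actions that it plays; it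
    suffices to minimize over the compact space U^T, and a minimizing sequence
    of actions is a policy that ignores the state. Empirical measures stay
    empirical, and their support points depend continuously on the actions,
    because on them attention is a quotient of finite sums. The optimal transport
    cost between empirical measures is continuous in the support points: since
    the positional encodings identify the particles, a coupling is carried over
    to nearby support points by moving each particle to its new place, at a cost
    controlled by the displacements. *)

(** * Preliminaries on probabilities and subspaces *)

Lemma probability_ext {d0} {X : measurableType d0} {R : realType}
    (P Q : probability X R) :
  (P : set X -> \bar R) = Q -> P = Q.
Proof.
(* Once the set functions agree, the other fields are proofs, identified by proof irrelevance. *)
case: P => p [[a1 a2] [b] [c] [e] [f] [g] [h]].
case: Q => q [[a1' a2'] [b'] [c'] [e'] [f'] [g'] [h']] /= pq; subst q.
by rewrite (Prop_irrelevance a1 a1') (Prop_irrelevance a2 a2')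
  (Prop_irrelevance b b') (Prop_irrelevance c c') (Prop_irrelevance e e')
  (Prop_irrelevance f f') (Prop_irrelevance g g') (Prop_irrelevance h h').
Qed.

Lemma nesub_val_continuous {X : topologicalType} {A : set X} (A0 : A !=set0) :
  continuous (\val : nesub A0 -> X).
Proof. exact: initial_continuous. Qed.

(** A proper filter on the subspace is pushed to [X] along the inclusion. Compactness yields a
    cluster point in [A], and it clusters in the subspace too because neighbourhoods there are
    traces of open sets. *)
Lemma compact_nesub {X : topologicalType} {A : set X} (A0 : A !=set0) :
  compact A -> compact [set: nesub A0].
Proof.
move=> cA F PF _.
have FA : ((\val : nesub A0 -> X) @ F) A.
  suff -> : ((\val : nesub A0 -> X) @ F) A = F [set: nesub A0] by exact: filterT.
  rewrite /fmap /=; congr F; apply/seteqP; split => // x _.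
  exact: (set_mem (valP x)).
have [x [Ax clx]] := cA _ (fmap_proper_filter _ PF) FA.
exists (in_nesub A0 Ax); split => // B C FB [_ [[W oW <-] Wx WC]].
have [y [[b Bb <-] Wb]] : ((\val : nesub A0 -> X) @` B) `&` W !=set0.
  apply: clx; last exact: open_nbhs_nbhs.
  have BS : B `<=` (\val : nesub A0 -> X) @^-1` ((\val : nesub A0 -> X) @` B).
    by move=> b Bb; exists b.
  exact: (filterS BS FB).
by exists b; split => //; exact: WC.
Qed.

(** * Push-forward of, and integration against, empirical measures *)

Section EmpiricalMeasure.
Context {R : realType} {N : nat} (N0 : (0 < N)%N).

Lemma pushp_empirical {X Y : ptopologicalType} (pts : 'I_N -> X) (f : X -> Y)
    (mf : measurable_fun setT (f : borel X -> borel Y)) :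
  pushp (empirical N0 pts : Prob R X) mf = empirical N0 (f \o pts).
Proof. by apply: probability_ext; apply/funext => A. Qed.

Lemma ge0_integral_empirical {X : ptopologicalType} (pts : 'I_N -> X)
    (g : X -> \bar R) :
  measurable_fun setT (g : borel X -> \bar R) -> (forall x, 0 <= g x)%E ->
  (\int[(empirical N0 pts : Prob R X) : probability _ R]_x g x =
   (N%:R^-1)%:E * \sum_(i < N) g (pts i))%E.
Proof.
move=> mg g0.
have invN_ge0 : 0 <= N%:R^-1 :> R by rewrite invr_ge0.
(* [msum] is indexed by the naturals; the default [Ordinal N0] is never reached for indices below
   [N]. *)
pose dirac_nat (i : nat) : {measure set (borel X) -> \bar R} :=
  dirac (pts (insubd (Ordinal N0) i) : borel X).
have -> : (\int[(empirical N0 pts : Prob R X) : probability _ R]_x g x =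
   \int[mscale (NngNum invN_ge0) (msum dirac_nat N)]_x g x)%E.
  apply: eq_measure_integral => A mA _.
  by rewrite [LHS](congr1 (fun m => m A) (empirical_measureE N0 pts)).
rewrite ge0_integral_mscale//; congr (_ * _)%E.
rewrite ge0_integral_measure_sum//; apply: eq_bigr => i _.
by rewrite integral_dirac// diracT mul1e valKd.
Qed.

(** The integrals of the positive and negative parts are finite averages, so their difference is
    computed in [R] and recombined term by term. *)
Lemma Rintegral_empirical {X : ptopologicalType} (pts : 'I_N -> X)
    (g : X -> R) :
  measurable_fun setT (g : borel X -> R) ->
  \int[(empirical N0 pts : Prob R X) : probability _ R]_x g x =
   N%:R^-1 * \sum_(i < N) g (pts i).
Proof.
move=> mg; have mE : measurable_fun setT ((EFin \o g) : borel X -> \bar R).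
  exact/measurable_EFinP.
rewrite /Rintegral integralE !ge0_integral_empirical//.
- under eq_bigr do rewrite (funeposE (fun x => (g x)%:E)) -EFin_max.
  under [X in (_ - _ * X)%E]eq_bigr do
    rewrite (funenegE (fun x => (g x)%:E)) -EFinN -EFin_max.
  rewrite !sumEFin -!EFinM -EFinB /= -mulrBr -sumrB; congr (_ * _).
  apply: eq_bigr => i _; have [g0|g0] := lerP 0 (g (pts i)).
    by rewrite max_r ?oppr_le0// subr0.
  by rewrite max_l ?oppr_ge0 ?ltW// sub0r opprK.
- exact: measurable_funeneg.
- exact: measurable_funepos.
Qed.

End EmpiricalMeasure.

(** * Continuity of matrix expressions *)

Section MatrixContinuity.
Context {R : realType} {Z : topologicalType}.

(** A neighbourhood of a matrix contains a product of neighbourhoods of its finitely many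
    entries. *)
Lemma continuous_mx {m n : nat} (M : Z -> 'M[R]_(m, n)) :
  (forall i j, continuous (fun z => M z i j)) -> continuous M.
Proof.
move=> cM z B [P nP sP].
have nearP : \forall w \near z, forall i j, P i j (M w i j).
  apply: (@filter_forall _ _ (fun i => [set w | forall j, P i j (M w i j)])
    (nbhs z)) => i.
  apply: (@filter_forall _ _ (fun j => [set w | P i j (M w i j)])
    (nbhs z)) => j.
  exact: (cM i j z _ (nP i j)).
by apply: filterS nearP => w; exact: sP.
Qed.

Lemma continuous_coord {m n : nat} (M : Z -> 'M[R]_(m, n)) i j :
  continuous M -> continuous (fun z => M z i j).
Proof.
move=> cM z; apply: (@continuous_comp _ _ _ M (fun v => v i j)); first exact: cM.
exact: coord_continuous.
Qed.

Lemma continuous_sum {I : Type} (r : seq I) (F : I -> Z -> R) :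
  (forall i, continuous (F i)) -> continuous (fun z => \sum_(i <- r) F i z).
Proof.
move=> cF z; apply: (@cvg_big _ _ _ _ _ (@add_continuous R^o) _ (nbhs z)) => i _.
exact: cF.
Qed.

Lemma continuous_mul (f g : Z -> R) :
  continuous f -> continuous g -> continuous (fun z => f z * g z).
Proof. by move=> cf cg z; apply: cvgM; [exact: cf|exact: cg]. Qed.

Lemma continuous_mulmx {m n p : nat} (A : Z -> 'M[R]_(m, n))
    (B : Z -> 'M[R]_(n, p)) :
  continuous A -> continuous B -> continuous (fun z => A z *m B z).
Proof.
move=> cA cB; apply: continuous_mx => i j.
under eq_fun do rewrite mxE.
by apply: continuous_sum => k; apply: continuous_mul; exact: continuous_coord.
Qed.

Lemma continuous_addmx {m n : nat} (A B : Z -> 'M[R]_(m, n)) :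
  continuous A -> continuous B -> continuous (fun z => A z + B z).
Proof.
move=> cA cB; apply: continuous_mx => i j; under eq_fun do rewrite mxE.
by move=> z; apply: (@cvgD R R^o _ (nbhs z)); exact: continuous_coord.
Qed.

Lemma continuous_dotv {n : nat} (u v : Z -> 'cV[R]_n) :
  continuous u -> continuous v -> continuous (fun z => dotv (u z) (v z)).
Proof.
move=> cu cv; under eq_fun do rewrite dotvE.
by apply: continuous_sum => k; apply: continuous_mul; exact: continuous_coord.
Qed.

End MatrixContinuity.

(** * The dynamics on support points *)

Section EmpiricalDynamics.
Context {R : realType} {N K d d1 d2 T : nat}.
Context {S : set 'cV[R]_d} {U : set (param R d d1 d2)}.
Variables (beta : R) (sigma : 'cV[R]_d1 -> 'cV[R]_d1).
Variables (N0 : (0 < N)%N) (S0 : S !=set0) (U0 : U !=set0).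
Variables (fX : f_X_valued beta sigma N0 S0 U0) (lip_sigma : lipschitz1 sigma).

Definition token_measure (x : 'I_N -> token S0) : Prob R (encoded N0 S0) :=
  empirical N0 (fun i => enc N0 i (x i)).

Definition step (u : action U0) (x : 'I_N -> token S0) (i : 'I_N) : token S0 :=
  in_nesub S0 (fX (enc N0 i (x i)) u (token_measure x)).

(** Mirrors the recursion of [evolution], including the branch that freezes the state past time [T],
    so that induction can match the two. *)
Fixpoint trajectory (u : 'I_T -> action U0) (x : 'I_K -> 'I_N -> token S0)
    (s : nat) : 'I_K -> 'I_N -> token S0 :=
  if s is s'.+1 then
    if insub s' is Some t then fun k => step (u t) (trajectory u x s' k)
    else trajectory u x s'
  else x.

Lemma marginal_token_measure x :
  marginal (token_measure x) = empirical N0 x :> Prob R (token S0).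
Proof.
rewrite /marginal pushp_empirical; congr empirical.
by apply/funext => i; exact: val_inj.
Qed.

Lemma Phi_token_measure x u :
  Phi fX lip_sigma (token_measure x) u = token_measure (step u x).
Proof.
rewrite /Phi pushp_empirical; congr empirical.
by apply/funext => i; exact: val_inj.
Qed.

Lemma evolution_open_loop (u : 'I_T -> action U0) x s :
  evolution fX lip_sigma (fun t _ => u t) (sample_measure N0 x) s =
  sample_measure N0 (trajectory u x s).
Proof.
elim: s => [//|s IHs] /=; case: insubP => [t _ _|_]; last exact: IHs.
by rewrite IHs; apply/funext => k; exact: Phi_token_measure.
Qed.

(** Along a deterministic evolution only the visited states matter, so recording the action played
    at each of them turns a feedback policy into a sequence of actions. *)
Lemma evolution_feedback (gamma : policy K T N0 S0 U0) mu s :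
  evolution fX lip_sigma gamma mu s =
  evolution fX lip_sigma
    (fun t _ => gamma t (evolution fX lip_sigma gamma mu t)) mu s.
Proof.
elim: s => [//|s IHs] /=; case: insubP => [t _ ts|_] //.
by rewrite -IHs ts.
Qed.

(** Both attention integrals become finite averages, which leaves an explicit formula from which
    continuity can be read off. *)
Lemma val_step u x i : \val (step u x i) =
  let: (W, A, b, Q, Ky, Vl) := \val u in
  W *m sigma (A *m \val (x i) + b) + \col_a
    ((N%:R^-1 * \sum_(j < N)
       (expR (beta * dotv (Q *m \val (x i)) (Ky *m \val (x j))) *
        (Vl *m \val (x j)) a 0)) /
     (N%:R^-1 * \sum_(j < N)
       expR (beta * dotv (Q *m \val (x i)) (Ky *m \val (x j))))).
Proof.
rewrite [LHS]/= /f_token; case: (\val u) => [[[[[W A] b] Q] Ky] Vl].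
congr (_ + _); apply/matrixP => a a'; rewrite !mxE marginal_token_measure.
pose e (z : borel (token S0)) : R :=
  expR (beta * dotv (Q *m \val (x i)) (Ky *m \val z)).
have me : measurable_fun setT e.
  apply: (measurableT_comp (@measurable_expR R)); apply: measurable_funM => //.
  under eq_fun do rewrite dotvE.
  apply: measurable_sum => j; apply: measurable_funM => //.
  exact: (measurable_mulmx Ky (@measurable_token _ _ _ S0) j).
congr (_ * _^-1); rewrite (Rintegral_empirical _ _ _)//.
by apply: measurable_funM => //; exact: (measurable_mulmx Vl (@measurable_token _ _ _ S0) a).
Qed.

(** The action and the tokens vary together over an arbitrary parameter space, so that the statement
    can be iterated along a trajectory. *)
Lemma continuous_step {Z : topologicalType} (u : Z -> action U0)
    (x : Z -> 'I_N -> token S0) :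
  continuous u -> (forall i, continuous (fun z => \val (x z i))) ->
  forall i, continuous (fun z => \val (step (u z) (x z) i)).
Proof.
move=> cu cx i.
have cval : continuous (fun z => \val (u z)).
  move=> z; apply: continuous_comp; first exact: cu.
  exact: nesub_val_continuous.
have cfst (X Y : topologicalType) (h : Z -> X * Y) :
  continuous h -> continuous (fun z => (h z).1).
  by move=> ch z; apply: continuous_comp; [exact: ch|exact: cvg_fst].
have csnd (X Y : topologicalType) (h : Z -> X * Y) :
  continuous h -> continuous (fun z => (h z).2).
  by move=> ch z; apply: continuous_comp; [exact: ch|exact: cvg_snd].
(* The action is a left-nested tuple; its six components are peeled off from the right. *)
pose W z := (\val (u z)).1.1.1.1.1; pose A z := (\val (u z)).1.1.1.1.2.
pose b z := (\val (u z)).1.1.1.2; pose Q z := (\val (u z)).1.1.2.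
pose Ky z := (\val (u z)).1.2; pose Vl z := (\val (u z)).2.
have cV : continuous Vl by exact: csnd.
have c1 := cfst _ _ _ cval.
have cKy : continuous Ky by exact: csnd.
have c2 := cfst _ _ _ c1.
have cQ : continuous Q by exact: csnd.
have c3 := cfst _ _ _ c2.
have cb : continuous b by exact: csnd.
have c4 := cfst _ _ _ c3.
have cA : continuous A by exact: csnd.
have cW : continuous W by exact: cfst.
pose e z j := expR (beta * dotv (Q z *m \val (x z i)) (Ky z *m \val (x z j))).
have ce j : continuous (e ^~ j).
  move=> z; apply: (@continuous_comp _ _ _
    (fun z => beta * dotv (Q z *m \val (x z i)) (Ky z *m \val (x z j))) expR).
    apply: continuous_mul; first by move=> ?; exact: cvg_cst.
    by apply: continuous_dotv; exact: continuous_mulmx.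
  exact: continuous_expR.
have sE : (fun z => \val (step (u z) (x z) i)) = (fun z =>
    W z *m sigma (A z *m \val (x z i) + b z) + \col_a
    ((N%:R^-1 * \sum_(j < N) (e z j * (Vl z *m \val (x z j)) a 0)) /
     (N%:R^-1 * \sum_(j < N) e z j))).
  apply/funext => z; rewrite val_step /W /A /b /e /Q /Ky /Vl.
  by case: (\val (u z)) => [[[[[? ?] ?] ?] ?] ?].
rewrite sE; apply: continuous_addmx.
  apply: continuous_mulmx => // z.
  apply: (@continuous_comp _ _ _ (fun z => A z *m \val (x z i) + b z) sigma).
    by apply: continuous_addmx => //; exact: continuous_mulmx.
  exact: lipschitz1_continuous.
apply: continuous_mx => a a'; under eq_fun do rewrite mxE.
apply: (continuous_mul
  (fun z => N%:R^-1 * \sum_(j < N) (e z j * (Vl z *m \val (x z j)) a 0))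
  (fun z => (N%:R^-1 * \sum_(j < N) e z j)^-1)).
  apply: continuous_mul; first by move=> ?; exact: cvg_cst.
  apply: continuous_sum => j; apply: continuous_mul => //.
  by apply: continuous_coord; exact: continuous_mulmx.
(* The denominator does not vanish: it has at least one term, since [N > 0], and its terms are
   positive exponentials. *)
move=> z; apply: cvgV.
  rewrite mulf_neq0 ?invr_eq0 ?pnatr_eq0 -?lt0n//.
  rewrite gt_eqF// (bigD1 (Ordinal N0))//= ltr_pwDl ?expR_gt0//.
  by apply: sumr_ge0 => j _; exact: expR_ge0.
apply: cvgM; first exact: cvg_cst.
exact: continuous_sum.
Qed.

Lemma continuous_trajectory (x : 'I_K -> 'I_N -> token S0) s k i :
  continuous (fun u : prod_topology (fun _ : 'I_T => action U0) =>
    \val (trajectory u x s k i)).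
Proof.
elim: s k i => [|s IHs] k i /=; first by move=> ?; exact: cvg_cst.
case: insubP => [t _ _|_]; last exact: IHs.
apply: (continuous_step (fun u : prod_topology _ => u t)
  (fun u => trajectory u x s k)) => [|j]; last exact: IHs.
exact: (@proj_continuous 'I_T (fun=> action U0) t).
Qed.

End EmpiricalDynamics.

(** * Optimal transport between empirical measures with labelled particles *)

Section OptimalTransport.
Context {R : realType} {N d : nat} {S : set 'cV[R]_d}.
Variables (N0 : (0 < N)%N) (S0 : S !=set0).
Local Notation X := (encoded N0 S0).

Lemma posenc_inj : injective (@posenc R N).
Proof.
have N1 : N%:R^-1 != 0 :> R by rewrite invr_eq0 pnatr_eq0 -lt0n.
by move=> i j /(mulIf N1) /eqP; rewrite eqr_nat => /eqP [] /val_inj.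
Qed.

(** The index is chosen, but [posenc_inj] leaves only one candidate. *)
Definition enc_index (x : X) : 'I_N := sval (cid2 (PE_enc_pos x)).

Lemma posenc_index x : posenc (enc_index x) = enc_pos x :> R.
Proof. by rewrite /enc_index; case: cid2. Qed.

Lemma enc_indexK i (y : token S0) : enc_index (enc N0 i y) = i.
Proof. by apply: posenc_inj; rewrite posenc_index. Qed.

(** Keeps the label of the particle and moves it to the place that [z] prescribes. It is defined on
    all of [X], hence applies to any coupling. *)
Definition relocate (z : 'I_N -> token S0) (x : X) : X :=
  enc N0 (enc_index x) (z (enc_index x)).

Lemma relocate_enc z i (y : token S0) : relocate z (enc N0 i y) = enc N0 i (z i).
Proof. by rewrite /relocate enc_indexK. Qed.

Lemma enc_pos_relocate z x : enc_pos (relocate z x) = enc_pos x.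
Proof. exact: posenc_index. Qed.

Lemma measurable_enc_pos : measurable_fun setT (enc_pos : borel X -> R).
Proof. by apply: continuous_borel; exact: continuous_enc_pos. Qed.

Lemma measurable_relocate z :
  measurable_fun setT (relocate z : borel X -> borel X).
Proof.
apply: measurable_to_nesub => [|l] /=.
  by under eq_fun do rewrite posenc_index; exact: measurable_enc_pos.
(* Each coordinate is constant on every fibre of the position, hence a finite combination of
   indicators of these fibres. *)
rewrite (_ : (fun _ => _) = (fun x : borel X => \sum_(j < N)
    \val (z j) l 0 * \1_(enc_pos @^-1` [set posenc j]) x)).
  apply: measurable_sum => j; apply: measurable_funM => //.
  apply: measurable_indic; rewrite -[X in measurable X]setTI.
  by apply: measurable_enc_pos => //; exact: measurable_set1.
apply/funext => x /=; rewrite (bigD1 (enc_index x))//= big1 ?addr0.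
  by rewrite indicE mem_set ?mulr1//= posenc_index.
move=> j ji; rewrite indicE memNset ?mulr0//= -posenc_index => /posenc_inj ij.
by rewrite ij eqxx in ji.
Qed.

Lemma pushp_relocate x z :
  pushp (token_measure N0 S0 x) (measurable_relocate z) = token_measure N0 S0 z.
Proof.
rewrite pushp_empirical; congr empirical.
by apply/funext => i; exact: relocate_enc.
Qed.

Lemma enorm_sqr n (v : 'cV[R]_n) : enorm v ^+ 2 = \sum_i v i 0 ^+ 2.
Proof.
rewrite /enorm dotvE sqr_sqrtr; first by apply: eq_bigr => i _; rewrite expr2.
by apply: sumr_ge0 => i _; rewrite -expr2 sqr_ge0.
Qed.

Variables (lambda : R) (lambda_ge0 : 0 <= lambda).
Local Notation cost := (@transport_cost R N d S N0 S0 lambda).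

Lemma transport_cost_ge0 (w : X * X) : 0 <= cost w.
Proof. by rewrite addr_ge0 ?mulr_ge0 ?exprn_ge0 ?sqrtr_ge0. Qed.

Lemma measurable_transport_cost : measurable_fun setT
  (cost : (borel X * borel X)%type -> R).
Proof.
rewrite /transport_cost; apply: measurable_funD.
  under eq_fun do rewrite enorm_sqr.
  apply: measurable_sum => l; apply: measurable_funX.
  under eq_fun do rewrite !mxE.
  apply: measurable_funB.
    exact: (measurableT_comp (@measurable_enc_tok _ _ _ _ N0 S0 l) measurable_fst).
  exact: (measurableT_comp (@measurable_enc_tok _ _ _ _ N0 S0 l) measurable_snd).
apply: measurable_funM => //; apply: measurable_funX.
apply: measurableT_comp => //; apply: measurable_funB.
  exact: (measurableT_comp measurable_enc_pos measurable_fst).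
exact: (measurableT_comp measurable_enc_pos measurable_snd).
Qed.

Lemma measurable_EFin_transport_cost : measurable_fun setT
  ((fun w : X * X => (cost w)%:E) : (borel X * borel X)%type -> \bar R).
Proof. by apply/measurable_EFinP; exact: measurable_transport_cost. Qed.

(** The squared distance: before the root is taken, perturbations of the cost simply add up. *)
Definition optimal_cost (P Q : Prob R X) : \bar R :=
  ereal_inf [set (\int[pi]_z (cost z)%:E)%E
            | pi in couplings P Q].

Lemma optimal_cost_ge0 P Q : (0 <= optimal_cost P Q)%E.
Proof.
apply: le_ereal_inf_tmp => _ [pi _ <-].
by apply: integral_ge0 => w _; rewrite lee_fin transport_cost_ge0.
Qed.

Lemma W2_sqr P Q : (W2 lambda P Q ^+ 2 = optimal_cost P Q)%E.
Proof.
by rewrite /W2 poweR12_sqrt ?sqr_sqrte//; exact: optimal_cost_ge0.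
Qed.

(** The image of the first measure on the graph of [relocate y] is a coupling, and its cost is a
    finite average. *)
Lemma optimal_cost_fin_num x y :
  optimal_cost (token_measure N0 S0 x) (token_measure N0 S0 y) \is a fin_num.
Proof.
have mg : measurable_fun setT
    ((fun w => (w, relocate y w)) : borel X -> (borel X * borel X)%type).
  by apply: measurable_fun_pair => //; exact: measurable_relocate.
pose g : {mfun borel X >-> (borel X * borel X)%type} := mfun_Sub (mem_set mg).
rewrite ge0_fin_numE ?optimal_cost_ge0//.
pose P := token_measure N0 S0 x : probability (borel X) R.
apply: (@le_lt_trans _ _ (\int[distribution P g]_z (cost z)%:E)%E).
  apply: ereal_inf_lbound; exists (distribution P g) => // A mA; split.
    rewrite /distribution /pushforward /=.
    by suff -> : g @^-1` (A `*` setT) = A by []; apply/seteqP; split => w // [].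
  rewrite -(pushp_relocate x y) /distribution /pushforward /=.
  suff -> : g @^-1` (setT `*` A) = relocate y @^-1` A by [].
  by apply/seteqP; split => w // [].
rewrite ge0_integral_distribution//.
- rewrite ge0_integral_empirical//.
  + by rewrite sumEFin -EFinM ltry.
  + exact: measurableT_comp measurable_EFin_transport_cost mg.
  + by move=> w; rewrite lee_fin transport_cost_ge0.
- exact: measurable_EFin_transport_cost.
- by move=> w; rewrite lee_fin transport_cost_ge0.
Qed.

(* The positional encoding identifies the particle, so almost surely the first
   marginal sits on the prescribed support point. *)
Lemma ae_relocate x (Q : Prob R X) (pi : probability (borel X * borel X)%type R) :
  couplings (token_measure N0 S0 x) Q pi ->
  {ae pi, forall w, relocate x (w.1 : X) = w.1}.
Proof.
move=> piC.
(* Equality of tokens is stated by coordinates, which makes [A] a finite intersection of sets where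
   two measurable real functions agree. *)
pose A : set (borel X) := [set v : X |
  forall l, enc_tok v l 0 = enc_tok (relocate x v) l 0].
have mA : measurable A.
  rewrite (_ : A = \bigcap_(l : 'I_d)
      [set v : X | enc_tok v l 0 == enc_tok (relocate x v) l 0]).
    apply: fin_bigcap_measurable; first exact: finite_finset.
    move=> l _; rewrite -[X in measurable X]setTI.
    apply: (@measurable_fun_eqr _ (borel X) R setT
      (fun v => enc_tok (v : X) l 0)
      (fun v => enc_tok (relocate x v) l 0) _ _ measurableT [set true]) => //.
      exact: measurable_enc_tok.
    exact: measurableT_comp (@measurable_enc_tok _ _ _ _ N0 S0 l)
      (measurable_relocate x).
  by apply/seteqP; split => [v Av l _|v Av l]; apply/eqP; exact: Av.
exists (~` A `*` setT); split.
- by apply: measurableX => //; exact: measurableC.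
- rewrite (piC _ (measurableC mA)).1 /token_measure /empirical /=.
  rewrite /empirical_measure big1 ?mule0// => i _; rewrite diracE memNset//.
  by move=> /=; apply; move=> l; rewrite relocate_enc.
- move=> w /= nw; split => // Aw; apply: nw; apply: val_inj => /=.
  rewrite posenc_index [RHS]surjective_pairing; congr (_, _).
  by apply/matrixP => l l'; rewrite (ord1 l'); exact/esym/Aw.
Qed.

(** Relocating the first component of a coupling for [x] gives a coupling for [z]. Positions do not
    change, so only the token part of the cost moves, by at most [L] almost surely. *)
Lemma optimal_cost_perturb x z (Q : Prob R X) (L : R) :
  0 <= L ->
  (forall i (y : token S0), enorm (\val (z i) - \val y) ^+ 2 <=
    enorm (\val (x i) - \val y) ^+ 2 + L) ->
  (optimal_cost (token_measure N0 S0 z) Q <=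
   optimal_cost (token_measure N0 S0 x) Q + L%:E)%E.
Proof.
move=> L0 zxL; rewrite -leeBlDr//.
apply: le_ereal_inf_tmp => _ [pi piC <-]; rewrite leeBlDr//.
have mg : measurable_fun setT ((fun w => (relocate z (w.1 : X), w.2 : X)) :
    (borel X * borel X)%type -> (borel X * borel X)%type).
  apply: measurable_fun_pair => //.
  exact: measurableT_comp (measurable_relocate z) measurable_fst.
pose g : {mfun (borel X * borel X)%type >-> (borel X * borel X)%type} :=
  mfun_Sub (mem_set mg).
apply: (@le_trans _ _ (\int[distribution pi g]_w (cost w)%:E)%E).
  apply: ereal_inf_lbound; exists (distribution pi g) => // A mA; split.
    rewrite -(pushp_relocate x z) /distribution /pushforward /=.
    have mB : measurable (relocate z @^-1` A : set (borel X)).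
      by rewrite -[X in measurable X]setTI; exact: measurable_relocate.
    by rewrite -(piC _ mB).1; congr (pi _).
  by rewrite -(piC _ mA).2 /distribution /pushforward.
rewrite ge0_integral_distribution//; last 2 first.
- exact: measurable_EFin_transport_cost.
- by move=> w; rewrite lee_fin transport_cost_ge0.
(* The total mass of [pi] is 1, so the constant [L] goes under the integral. *)
have -> : (\int[pi]_w (cost w)%:E + L%:E = \int[pi]_w ((cost w)%:E + L%:E))%E.
  rewrite ge0_integralD//.
  - have piT : pi [set: borel X * borel X] = 1%E := probability_setT pi.
    rewrite integral_cst//; congr (_ + _)%E.
    by rewrite -[LHS]mule1; congr (_ * _)%E; exact/esym/piT.
  - by move=> w _; rewrite lee_fin transport_cost_ge0.
  - exact: measurable_EFin_transport_cost.
apply: ae_ge0_le_integral => //.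
- by move=> w _; rewrite lee_fin transport_cost_ge0.
- exact: measurableT_comp measurable_EFin_transport_cost mg.
- by move=> w _; rewrite adde_ge0// lee_fin ?transport_cost_ge0.
- by apply: emeasurable_funD => //; exact: measurable_EFin_transport_cost.
have [B [mB B0 sB]] := ae_relocate _ _ _ piC.
exists B; split => // w nw; apply: sB => /= wx; apply: nw => _.
rewrite /= -EFinD lee_fin /transport_cost /= addrAC lerD//.
  (* [wx] replaces [w.1] by the support point of [x] with the same index, to which [zxL] applies. *)
  rewrite -{2}wx.
  exact: (zxL (enc_index (w.1 : X)) (proj_token (w.2 : X))).
by rewrite enc_pos_relocate.
Qed.

(** In each coordinate the difference of squares factors as [(u + v - 2w)(u - v)], and the first
    factor is at most [4 * M] in absolute value. *)
Lemma enorm_sqr_perturb (M : R) (u v w : 'cV[R]_d) :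
  (forall l, [/\ `|u l 0| <= M, `|v l 0| <= M & `|w l 0| <= M]) ->
  enorm (u - w) ^+ 2 <=
  enorm (v - w) ^+ 2 + \sum_l (4 * M) * `|u l 0 - v l 0|.
Proof.
move=> uvwM; rewrite !enorm_sqr -big_split/=; apply: ler_sum => l _.
have [uM vM wM] := uvwM l; rewrite !mxE -lerBlDl.
have -> : (u l 0 - w l 0) ^+ 2 - (v l 0 - w l 0) ^+ 2 =
  (u l 0 + v l 0 - w l 0 - w l 0) * (u l 0 - v l 0) by ring.
apply: (le_trans (ler_norm _)); rewrite normrM; apply: ler_wpM2r => //.
move: uM vM wM; rewrite !ler_norml => /andP[? ?] /andP[? ?] /andP[? ?].
by apply/andP; split; lra.
Qed.

Lemma optimal_cost_lipschitz (M : R) x z y :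
  (forall (v : token S0) l, `|\val v l 0| <= M) ->
  `|fine (optimal_cost (token_measure N0 S0 z) (token_measure N0 S0 y)) -
    fine (optimal_cost (token_measure N0 S0 x) (token_measure N0 S0 y))| <=
  \sum_i \sum_l (4 * M) * `|\val (z i) l 0 - \val (x i) l 0|.
Proof.
move=> SM.
(* The bound [SM] at the coordinate [l] itself forces [0 <= M]. *)
have term_ge0 (x' z' : 'I_N -> token S0) i l :
    0 <= 4 * M * `|\val (z' i) l 0 - \val (x' i) l 0|.
  by rewrite mulr_ge0 ?mulr_ge0// (le_trans _ (SM (x i) l)).
(* The modulus is symmetric in the two configurations, so a one-sided bound suffices. *)
suff half (x' z' : 'I_N -> token S0) :
    fine (optimal_cost (token_measure N0 S0 z') (token_measure N0 S0 y)) <=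
    fine (optimal_cost (token_measure N0 S0 x') (token_measure N0 S0 y)) +
    \sum_i \sum_l (4 * M) * `|\val (z' i) l 0 - \val (x' i) l 0|.
  rewrite ler_norml lerBlDl half andbT lerBrDl lerBlDr.
  under eq_bigr do under eq_bigr do rewrite distrC.
  exact: half.
have L0 i : 0 <= \sum_l (4 * M) * `|\val (z' i) l 0 - \val (x' i) l 0|.
  by apply: sumr_ge0 => l _; exact: term_ge0.
rewrite -lee_fin EFinD !fineK ?optimal_cost_fin_num//.
apply: optimal_cost_perturb => [|i v]; first by apply: sumr_ge0.
apply: (le_trans (enorm_sqr_perturb M _ (\val (x' i)) _ _)) => //.
(* [L] must not depend on the particle, so the displacement of particle [i] is bounded by the sum
   over all particles. *)
by rewrite lerD2l (bigD1 i)//= lerDl; apply: sumr_ge0 => j _; exact: L0.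
Qed.

End OptimalTransport.

(** * Existence of a minimizing sequence of actions *)

Lemma continuous_of_modulus {R : realType} {Z : topologicalType} (h : Z -> R)
    (D : Z -> Z -> R) :
  (forall u v, `|h v - h u| <= D u v) ->
  (forall u, D u v @[v --> u] --> 0) -> continuous h.
Proof.
move=> hD D0 u; apply/cvgrPdistC_lt => e e0.
move/cvgr_lt : (D0 u) => /(_ _ e0); apply: filterS => v; exact: le_lt_trans.
Qed.

Lemma compact_coord_bounded {R : realType} {d : nat} {S : set 'cV[R]_d}
    (S0 : S !=set0) :
  compact S -> exists M : R, forall (v : token S0) l, `|\val v l 0| <= M.
Proof.
(* [compact_bounded] bounds the norm by every real strictly above [M], hence [M + 1]; the norm is
   the largest absolute value of an entry. *)
move=> /compact_bounded [M [_ SM]]; exists (M + 1) => v l.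
apply: le_trans (SM (M + 1) _ (\val v) (set_mem (valP v))); last by rewrite ltrDl.
rewrite [leRHS](mx_normrE (\val v : 'cV[R]_d)).
exact: (le_bigmax _ (fun ij : 'I_d * 'I_1 => `|\val v ij.1 ij.2|) (l, 0)).
Qed.

Theorem theorem7 (R : realType) (N K d d1 d2 T : nat)
    (N_gt0 : (0 < N)%N) (K_gt0 : (0 < K)%N) (d_gt0 : (0 < d)%N)
    (d1_gt0 : (0 < d1)%N) (d2_gt0 : (0 < d2)%N) (T_gt0 : (0 < T)%N)
    (beta lambda : R) (beta_gt0 : 0 < beta) (lambda_gt0 : 0 < lambda)
    (S : set 'cV[R]_d) (S_neq0 : S !=set0)
    (sigma : 'cV[R]_d1 -> 'cV[R]_d1) (lip_sigma : lipschitz1 sigma)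
    (U : set (param R d d1 d2)) (U_neq0 : U !=set0)
    (fX : f_X_valued beta sigma N_gt0 S_neq0 U_neq0)
    (xs ys : 'I_K -> 'I_N -> token S_neq0)
    (compact_S : compact S) (compact_U : compact U)
    (lambda_diam : N%:R / 2 * diam S ^+ 2 < lambda)
    (C : nat -> ProbK R (encoded N_gt0 S_neq0) K -> \bar R)
    (C_T : forall mu, C T mu = terminal_cost lambda (sample_measure N_gt0 ys) mu)
    (C_t : forall t, (t < T)%N -> forall mu,
      C t mu = ereal_inf
        [set (\int[eta fX lip_sigma mu u]_mu' C t.+1 mu')%E
        | u in [set: action U_neq0]]) :
  exists2 gamma_star : policy K T N_gt0 S_neq0 U_neq0,
    Gamma gamma_star &
    policy_cost fX lip_sigma lambda xs ys gamma_star =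
      ereal_inf
        [set policy_cost fX lip_sigma lambda xs ys gamma
        | gamma in (Gamma : set (policy K T N_gt0 S_neq0 U_neq0))].
Proof.
have lambda_ge0 := ltW lambda_gt0.
have [M SM] := compact_coord_bounded S_neq0 compact_S.
pose Z : topologicalType := prod_topology (fun _ : 'I_T => action U_neq0).
pose x (u : Z) := trajectory beta sigma N_gt0 S_neq0 U_neq0 fX u xs T.
pose G k (u : Z) : R := fine (optimal_cost N_gt0 S_neq0 lambda
  (token_measure N_gt0 S_neq0 (x u k)) (token_measure N_gt0 S_neq0 (ys k))).
pose value (u : Z) : R := K%:R^-1 * \sum_(k < K) G k u.
have valueE (u : Z) : policy_cost fX lip_sigma lambda xs ys (fun t _ => u t) =
    (value u)%:E.
  rewrite /policy_cost evolution_open_loop /terminal_cost EFinM -sumEFin.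
  congr (_ * _)%E; apply: eq_bigr => k _.
  by rewrite W2_sqr// fineK// optimal_cost_fin_num.
have cvalue : continuous value.
  suff cG k : continuous (G k).
    by move=> u; apply: cvgM; [exact: cvg_cst|exact: continuous_sum].
  have cx i l : continuous (fun v : Z => \val (x v k i) l 0).
    apply: (@continuous_coord R Z d 1 (fun v => \val (x v k i))).
    exact: continuous_trajectory.
  pose D (u v : Z) : R :=
    \sum_i \sum_l (4 * M) * `|\val (x v k i) l 0 - \val (x u k i) l 0|.
  apply: (continuous_of_modulus _ D) => [u v|u].
    exact: optimal_cost_lipschitz.
  (* As [D u u = 0], the required limit is continuity of [D u] at [u]. *)
  have <- : D u u = 0.
    by rewrite /D big1// => i _; rewrite big1// => l _; rewrite subrr normr0 mulr0.
  suff : continuous (D u) by exact.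
  apply: continuous_sum => i; apply: continuous_sum => l; apply: continuous_mul.
    by move=> v; exact: cvg_cst.
  move=> v; apply: cvg_norm; apply: cvgB; last exact: cvg_cst.
  exact: cx.
(* Tychonoff's theorem for the finitely many copies of the compact action space. *)
have cZ : compact [set: Z].
  have := @tychonoff 'I_T (fun=> action U_neq0) (fun=> setT)
    (fun=> compact_nesub U_neq0 compact_U).
  by congr compact; apply/seteqP; split.
have Z0 : [set: Z] !=set0 by exists (fun=> point).
have [u _ umin] := compact_EVT_min Z0 cZ (continuous_subspaceT cvalue).
(* Maps that ignore the state are constant, hence measurable, so the minimizing sequence is an
   admissible policy. *)
have gammaG : Gamma ((fun t _ => u t) : policy K T N_gt0 S_neq0 U_neq0).
  by move=> t; exact: measurable_cst.
exists (fun t _ => u t) => //; apply/eqP; rewrite eq_le; apply/andP; split.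
  apply: le_ereal_inf_tmp => _ [gamma _ <-].
  (* The cost of [gamma] becomes [value] at the actions it plays, which [umin] bounds from below. *)
  rewrite [leRHS]/policy_cost evolution_feedback.
  by rewrite -/(policy_cost _ _ _ _ _ _) !valueE lee_fin umin// inE.
by apply: ereal_inf_lbound; exists (fun t _ => u t).
Qed.
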